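(* Let $k\ge 1$, let $0<r_1<\cdots<r_k$ be integers, let $d=\gcd(r_1,\ldots,r_k)$, and for each positive integer $n$ let $M_n=\langle n,n+r_1,\ldots,n+r_k\rangle$. For $n>r_k^2$ the function $n\mapsto g(M_n)$ is $r_k$-quasiquadratic in $n$; that is, there exist functions $a_0,a_1,a_2:\mathbb Z\to\mathbb R$, each periodic with period dividing $r_k$, with $a_2$ not identically zero on the integers coprime to $d$, such that $$g(M_n)=a_2(n)n^2+a_1(n)n+a_0(n)$$ for all integers $n>r_k^2$ with $\gcd(n,d)=1$.
   Context: $\langle g_1,\ldots,g_m\rangle$ denotes the additive submonoid of $\mathbb Z_{\ge0}$ generated by $g_1,\ldots,g_m$. For an additive submonoid $M\subseteq\mathbb Z_{\ge0}$ with $\gcd(M)=1$, the genus is $g(M)=|\mathbb Z_{\ge0}\setminus M|$. (When $\gcd(n,d)=1$ one has $\gcd(M_n)=1$.) *)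

(* Defs.v *)
From mathcomp Require Import all_boot all_order all_algebra.
From mathcomp Require Import finmap.
From mathcomp Require Import all_classical all_reals.
From mathcomp Require Import trigo.

Set Implicit Arguments.
Unset Strict Implicit.
Unset Printing Implicit Defensive.

Local Open Scope classical_set_scope.

Definition additive_submonoid (M : set nat) : Prop :=
  M 0 /\ forall x y, M x -> M y -> M (x + y).

Definition submonoid_gen (s : seq nat) : set nat :=
  smallest additive_submonoid [set` s].

(* [fset_set] sends infinite sets to the empty set, so [genus M] is meaningful
   only for M with finite complement, i.e. for submonoids with gcd 1. *)
Definition genus (M : set nat) : nat := #|` fset_set (~` M)|%fset.

Definition shifted_monoid (r : seq nat) (n : nat) : set nat :=
  submonoid_gen (n :: [seq n + x | x <- r]).

(* [periodic f p] on its own only says that p is some period of f and does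
   not exclude p = 0. *)
Definition period_dividing (V : zmodType) (f : int -> V) (m : nat) : Prop :=
  exists p : nat, [/\ 0 < p, p %| m & periodic f p%:Z].

(* Main.v *)
(** Let [L = r_k], let [d] be the gcd of the [r_i], and let [m s] be the least
    number of [r_i] with sum [s].  Then [x] lies in [M_n] iff [x = s + t n] for
    some sum [s] of [r_i] and some [t >= m s].  Trading zero-sum blocks modulo
    [L] for copies of [L] shows that a shortest factorization has fewer than
    [L] parts different from [L].  Hence [m (s + L) = m s + 1] for [s >= L^2],
    and, for [n > L^2], the least [s] in a class modulo [n] also minimises
    [s + m s * n], which is therefore the Apery element of that class.  Summing
    the floors of the Apery elements divided by [n] over the classes of [d j],
    [j < n], expresses [g(M_n)] by the sum of the [m (d j)], by finitely many
    corrections, and by the linear sum of the floors of [d j / n].  The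
    eventual quasi-linearity of [m] then gives
    [g(M_{n+2L}) - 2 g(M_{n+L}) + g(M_n) = d L], so the leading coefficient is
    the constant [d / (2 L)]. *)

Require Import Defs.
From mathcomp Require Import all_boot all_order all_algebra.
From mathcomp Require Import finmap.
From mathcomp Require Import all_classical all_reals.
From mathcomp Require Import trigo.
From mathcomp Require Import zify ring.

Set Implicit Arguments.
Unset Strict Implicit.
Unset Printing Implicit Defensive.

(** * Factorizations into steps and their least length *)

Definition factorization (r : seq nat) (s : nat) (u : seq nat) : bool :=
  all (mem r) u && (sumn u == s).

Definition spanned (r : seq nat) (s : nat) : bool :=
  `[< exists u, factorization r s u >].

Definition has_length (r : seq nat) (s l : nat) : bool :=
  `[< exists2 u, factorization r s u & size u = l >].

(* Junk value [0] when [s] is not spanned by [r]. *)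
Definition min_length (r : seq nat) (s : nat) : nat :=
  if pselect (exists l, has_length r s l) is left h then ex_minn h else 0.

Lemma min_length_le r s u : factorization r s u -> min_length r s <= size u.
Proof.
move=> su; rewrite /min_length; case: pselect => [h|]; last by [].
by case: ex_minnP => l _; apply; apply/asboolP; exists u.
Qed.

Lemma min_length_witness r s :
  spanned r s -> exists2 u, factorization r s u & size u = min_length r s.
Proof.
move=> /asboolP[u su]; rewrite /min_length; case: pselect => [h|[]].
  by case: ex_minnP => l /asboolP.
by exists (size u); apply/asboolP; exists u.
Qed.

Lemma factorization_spanned r s u : factorization r s u -> spanned r s.
Proof. by move=> su; apply/asboolP; exists u. Qed.

Lemma factorization_cat r s t u v :
  factorization r s u -> factorization r t v ->
  factorization r (s + t) (u ++ v).
Proof.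
rewrite /factorization all_cat sumn_cat => /andP[-> /eqP->] /andP[-> /eqP->] /=.
exact: eqxx.
Qed.

Lemma factorization_nseq r a x :
  x \in r -> factorization r (a * x) (nseq a x).
Proof.
move=> xr; rewrite /factorization sumn_nseq mulnC eqxx andbT.
by apply/allP => y /nseqP[-> _].
Qed.

(** * Zero-sum blocks and the shape of shortest factorizations *)

Lemma sumn_le_size (u : seq nat) L :
  (forall x, x \in u -> x <= L) -> sumn u <= L * size u.
Proof.
elim: u => [|x u IH] //= h; rewrite mulnS leq_add ?h ?mem_head //.
by apply: IH => y yu; rewrite h // in_cons yu orbT.
Qed.

Lemma sumn_lt_size (u : seq nat) L :
  (forall x, x \in u -> x < L) -> 0 < size u -> sumn u < L * size u.
Proof.
case: L => [|L] h u0; first by case: u h u0 => // x u /(_ x (mem_head _ _)).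
have := @sumn_le_size u L (fun x xu => h x xu); nia.
Qed.

(* Pigeonhole on the partial sums modulo [L]. *)
Lemma zero_sum_infix L (u : seq nat) :
  0 < L -> L <= size u ->
  exists a w b, [/\ u = a ++ w ++ b, 0 < size w & L %| sumn w].
Proof.
move=> L0 Lu.
pose f (i : 'I_L.+1) : 'I_L := Ordinal (ltn_pmod (sumn (take i u)) L0).
have : ~~ injectiveb f.
  by apply/injectiveP => /leq_card; rewrite !card_ord ltnn.
have split_pair (i j : nat) : i < j -> j <= L ->
    sumn (take i u) = sumn (take j u) %[mod L] ->
    exists a w b, [/\ u = a ++ w ++ b, 0 < size w & L %| sumn w].
  move=> ij jL e; exists (take i u), (drop i (take j u)), (drop j u).
  have tj : take j u = take i u ++ drop i (take j u).
    by rewrite -[in LHS](cat_take_drop i (take j u)) take_takel // ltnW.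
  split.
  - by rewrite catA -tj cat_take_drop.
  - by rewrite size_drop size_takel ?subn_gt0 // (leq_trans jL).
  - move/eqP: e; rewrite [in X in _ == X %[mod _]]tj sumn_cat.
    by rewrite -[X in X == _ %[mod _]]addn0 eqn_modDl mod0n eq_sym.
case/injectivePn => i [j ij /(congr1 val) /= e].
have [lt_ij|lt_ji|/val_inj eij] := ltngtP (i : nat) j.
- by apply: (split_pair i j) => //; rewrite -ltnS.
- by apply: (split_pair j i) => //; rewrite -ltnS.
- by rewrite eij eqxx in ij.
Qed.

(** What the combinatorial part retains of the increasing tuple of the theorem: positivity, and its
    largest entry [L]. *)
Definition steps_to (r : seq nat) (L : nat) : Prop :=
  L \in r /\ forall x, x \in r -> 0 < x <= L.

Lemma steps_to_gt0 r L : steps_to r L -> 0 < L.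
Proof. by case=> Lr /(_ _ Lr) /andP[]. Qed.

(* A zero-sum block of [c] parts smaller than [L] could be traded for fewer
   than [c] copies of [L], so fewer than [L] parts differ from [L]. *)
Lemma min_length_normal_form r L s :
  steps_to r L -> spanned r s ->
  exists a v, [/\ factorization r (sumn v) v, size v < L,
    sumn v <= L * size v, s = sumn v + a * L & min_length r s = size v + a].
Proof.
move=> stp /min_length_witness[u /andP[ur /eqP us] um].
have L0 := steps_to_gt0 stp; case: stp => Lr rL.
pose v := [seq x <- u | x != L]; pose a := count_mem L u.
have sz : size v + a = size u by rewrite size_filter addnC (count_predC (pred1 L) u).
have vr : all (mem r) v by apply/allP => x; rewrite mem_filter => /andP[_ /(allP ur)].
have sumE : s = sumn v + a * L.
  rewrite -us /v /a; elim: (u) => //= x w ->.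
  by case: eqVneq => [->|_] /=; lia.
have vL x : x \in v -> x < L.
  move=> xv; have /andP[_] := rL _ (allP vr _ xv).
  by rewrite leq_eqVlt; move: xv; rewrite mem_filter => /andP[/negPf-> _].
exists a, v; split => //.
- by rewrite /factorization vr eqxx.
- rewrite ltnNge; apply/negP => /(zero_sum_infix L0)[x [w [y [e w0 /dvdnP[c wc]]]]].
  have : sumn w < L * size w.
    by apply: sumn_lt_size => // z zw; apply: vL; rewrite e !mem_cat zw orbT.
  rewrite wc mulnC ltn_pmul2l // => cw.
  move: vr; rewrite e !all_cat => /and3P[xr _ yr].
  have : factorization r s ((x ++ y) ++ nseq (c + a) L).
    rewrite sumE e !sumn_cat wc (_ : _ + _ = sumn (x ++ y) + (c + a) * L).
      apply: factorization_cat; last exact: factorization_nseq.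
      by rewrite /factorization all_cat xr yr eqxx.
    by rewrite sumn_cat; lia.
  move/min_length_le; rewrite -um -sz e !size_cat size_nseq.
  by move: (size x) (size w) (size y) cw => p q t; clear; lia.
- by apply: sumn_le_size => x /vL /ltnW.
- by rewrite sz um.
Qed.

(** Fewer than [L] parts differ from [L], so the least length exceeds [s / L] by at most [L - 1].
    Together with the lower bound [s / L], this forbids a smaller least length once [s] grows by
    [L ^ 2 - L] or more. *)
Lemma min_length_upper r L s :
  steps_to r L -> spanned r s -> L * min_length r s + L <= s + L ^ 2.
Proof.
move=> stp /(min_length_normal_form stp)[a [v [_ vL _ -> ->]]].
have : L * (size v).+1 <= L * L by rewrite leq_mul2l vL orbT.
by nia.
Qed.

Lemma min_length_lower r L s :
  steps_to r L -> spanned r s -> s <= L * min_length r s.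
Proof.
move=> stp /(min_length_normal_form stp)[a [v [_ _ h -> ->]]]; nia.
Qed.

(** Parts other than [L] add up to at most [L * (L - 1)], so a shortest factorization of [s + L]
    contains a copy of [L], and deleting it gives the reverse inequality. *)
Lemma min_length_add_last r L s :
  steps_to r L -> spanned r s -> L ^ 2 <= s ->
  spanned r (s + L) /\ min_length r (s + L) = (min_length r s).+1.
Proof.
move=> stp Ss sL; have L0 := steps_to_gt0 stp; have [Lr _] := stp.
have [u us um] := min_length_witness Ss.
have LL : factorization r L [:: L] by rewrite /factorization /= Lr addn0 eqxx.
have fs := factorization_cat us LL.
have SsL := factorization_spanned fs; split=> //.
have := min_length_le fs; rewrite size_cat um /= addn1 => le1.
apply/eqP; rewrite eqn_leq le1 /=.
have [[|a] [v [fv vL vs e ->]]] := min_length_normal_form stp SsL; first nia.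
have {}e : s = sumn v + a * L by lia.
have := factorization_cat fv (factorization_nseq a Lr); rewrite -e.
by move/min_length_le; rewrite size_cat size_nseq; lia.
Qed.

Lemma min_length_add_mul r L s c :
  steps_to r L -> spanned r s -> L ^ 2 <= s ->
  min_length r (s + c * L) = min_length r s + c.
Proof.
move=> stp Ss sL.
suff [] : spanned r (s + c * L) /\ min_length r (s + c * L) = min_length r s + c by [].
elim: c => [|c [IH1 IH2]]; first by rewrite mul0n !addn0.
have -> : s + c.+1 * L = (s + c * L) + L by lia.
have [|h1 ->] := min_length_add_last stp IH1; first lia.
by rewrite IH2 addnS.
Qed.

(** * Sums of steps modulo [L] and the gcd *)

Lemma spanned_mod r L c :
  0 < L -> (forall x, x \in r -> 0 < x) ->
  exists2 y, spanned r y & y = c * \big[gcdn/0]_(x <- r) x %[mod L].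
Proof.
move=> L0; elim: r c => [|a r IH] c rpos.
  by exists 0; [apply/asboolP; exists [::] | rewrite big_nil muln0].
have a0 : 0 < a by apply: rpos; rewrite mem_head.
rewrite big_cons; set g := \big[gcdn/0]_(x <- r) x in IH *.
case: (egcdnP g a0) => u v uv _.
(* Bezout gives [u * a = v * g + gcdn a g]; modulo [L] the factor [L.-1] plays the role of [-1],
   which keeps all coefficients nonnegative. *)
have [|y Sy yE] := IH (v * L.-1 * c).
  by move=> x xr; apply: rpos; rewrite in_cons xr orbT.
have /asboolP[w /andP[wr /eqP ws]] := Sy.
exists (u * c * a + y).
  apply/asboolP; exists (nseq (u * c) a ++ w); apply: factorization_cat.
    by apply: factorization_nseq; rewrite mem_head.
  rewrite /factorization ws eqxx andbT; apply/allP => x /(allP wr) /= xr.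
  by rewrite in_cons xr orbT.
rewrite -modnDmr yE modnDmr.
have -> : u * c * a + v * L.-1 * c * g = (v * c * g) * L + c * gcdn a g.
  have -> : u * c * a = c * (u * a) by ring.
  rewrite uv; case: L L0 {IH yE} => // L _ /=; ring.
by rewrite modnMDl.
Qed.

Lemma spanned_dvd r s : spanned r s -> \big[gcdn/0]_(x <- r) x %| s.
Proof.
move=> /asboolP[u /andP[ur /eqP <-]].
rewrite sumnE [X in _ %| X]big_seq; apply: dvdn_sum => x /(allP ur) /= xr.
by rewrite (big_rem x) //= dvdn_gcdl.
Qed.

Lemma gcd_steps_dvd r L : steps_to r L -> \big[gcdn/0]_(x <- r) x %| L.
Proof. by case=> Lr _; rewrite (big_rem L) //= dvdn_gcdl. Qed.

Lemma gcd_steps_gt0 r L : steps_to r L -> 0 < \big[gcdn/0]_(x <- r) x.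
Proof. by move=> stp; apply: dvdn_gt0 (steps_to_gt0 stp) (gcd_steps_dvd stp). Qed.

Lemma coprime_add_steps r L n (d := \big[gcdn/0]_(x <- r) x) :
  steps_to r L -> coprime (n + L) d = coprime n d.
Proof.
move=> /gcd_steps_dvd/dvdnP[q ->].
by rewrite /coprime addnC gcdnC gcdnMDl gcdnC.
Qed.

(** Take a sum congruent to [d * j] modulo [L] and strip its copies of [L]: what remains is below
    [L ^ 2], hence below [d * j], and copies of [L] fill the difference. *)
Lemma spanned_large r L j :
  steps_to r L -> L ^ 2 <= j -> spanned r (\big[gcdn/0]_(x <- r) x * j).
Proof.
move=> stp jL; have L0 := steps_to_gt0 stp; have [Lr rL] := stp.
have d0 := gcd_steps_gt0 stp.
set d := \big[gcdn/0]_(x <- r) x in d0 *.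
have [|y Sy] := @spanned_mod r L j L0; first by move=> x /rL /andP[].
have [a [v [fv vL vs -> _]]] := min_length_normal_form stp Sy.
rewrite -/d addnC modnMDl => e.
have le : sumn v <= d * j by nia.
have /dvdnP[q qE] : L %| d * j - sumn v by rewrite -eqn_mod_dvd // mulnC e.
have -> : d * j = sumn v + q * L by lia.
exact/factorization_spanned/(factorization_cat fv)/factorization_nseq.
Qed.

(** * Membership in [M_n] and its Apery set *)

(** Each generator contributes one [n] and at most one step; copies of the generator [n] itself pad
    the count up to any larger [t]. *)
Lemma shifted_monoidP r n x :
  shifted_monoid r n x <->
  exists s t, [/\ spanned r s, min_length r s <= t & x = s + t * n].
Proof.
split.
- move=> /(_ [set y | exists s t,
    [/\ spanned r s, min_length r s <= t & y = s + t * n]]%classic).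
  apply; split => [|{}x]; first split.
  + have f0 : factorization r 0 [::] by [].
    exists 0, 0; split => //; first exact: factorization_spanned f0.
    exact: min_length_le f0.
  + move=> x1 x2 [s1 [t1 [S1 m1 ->]]] [s2 [t2 [S2 m2 ->]]].
    have [u1 f1 e1] := min_length_witness S1.
    have [u2 f2 e2] := min_length_witness S2.
    have f12 := factorization_cat f1 f2.
    exists (s1 + s2), (t1 + t2); split; last by ring.
      exact: factorization_spanned f12.
    by rewrite (leq_trans (min_length_le f12)) // size_cat e1 e2 leq_add.
  + rewrite /= in_cons => /predU1P[->|/mapP[y yr ->]].
      have f0 : factorization r 0 [::] by [].
      exists 0, 1; split; [exact: factorization_spanned f0| |by rewrite mul1n].
      exact: leq_trans (min_length_le f0) _.
    have fy : factorization r y [:: y] by rewrite /factorization /= yr addn0 eqxx.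
    exists y, 1; split; [exact: factorization_spanned fy| |by rewrite mul1n addnC].
    exact: leq_trans (min_length_le fy) _.
- move=> [s [t [Ss mt ->]]] M [[M0 MD] Mgen].
  have [u /andP[ur /eqP us] um] := min_length_witness Ss.
  have Mn : M n by apply: Mgen; rewrite /= mem_head.
  have {mt um} ut : size u <= t by rewrite um.
  rewrite -us {us}.
  elim: u ur t ut {Ss} => [|y u IH].
    by move=> _ t _ /=; rewrite add0n; elim: t => [|t IH] //; rewrite mulSn; apply: MD.
  rewrite /= => /andP[yr ur]; case=> [|t] // ut.
  have -> : y + sumn u + t.+1 * n = (n + y) + (sumn u + t * n) by ring.
  apply: MD; last exact: IH.
  by apply: Mgen; rewrite /= in_cons map_f ?orbT.
Qed.

(* For [j < n] this is the element of [<r>], divided by [d], that realises the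
   Apery set of the shifted monoid in the class of [d * j] modulo [n]. *)
Definition apery_rep (r : seq nat) (d n j : nat) : nat :=
  if spanned r (d * j) then j else j + n.

Definition apery (r : seq nat) (d n j : nat) : nat :=
  d * apery_rep r d n j + min_length r (d * apery_rep r d n j) * n.

Lemma apery_rep_spanned r L n j (d := \big[gcdn/0]_(x <- r) x) :
  steps_to r L -> L ^ 2 < n -> spanned r (d * apery_rep r d n j).
Proof.
move=> stp Ln; rewrite /apery_rep; case: ifP => // _.
by apply: (spanned_large stp); lia.
Qed.

Lemma modn_apery r d n j : apery r d n j = d * j %[mod n].
Proof.
rewrite /apery addnC modnMDl /apery_rep; case: ifP => // _.
by rewrite mulnDr addnC modnMDl.
Qed.

Lemma eqn_modMl_coprime n d i j :
  coprime n d -> (d * i == d * j %[mod n]) = (i == j %[mod n]).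
Proof.
move=> cnd; wlog le : i j / i <= j.
  move=> H; case: (leqP i j) => [/H//|/ltnW/H e].
  by rewrite eq_sym e eq_sym.
rewrite eq_sym [RHS]eq_sym !eqn_mod_dvd ?leq_mul2l ?le ?orbT //.
by rewrite -mulnBr Gauss_dvdr.
Qed.

(** As [n] and [d] are coprime, the sums of steps in the class of [d * j] have the form [d * q] with
    [q] among [j], [j + n], [j + 2 * n] and so on. [apery_rep] is the first [q] that is spanned, and
    no later one does better. *)
Lemma shifted_monoid_apery r L n x j (d := \big[gcdn/0]_(x <- r) x) :
  steps_to r L -> L ^ 2 < n -> coprime n d -> j < n -> x = d * j %[mod n] ->
  shifted_monoid r n x <-> apery r d n j <= x.
Proof.
move=> stp Ln cnd jn xj; rewrite shifted_monoidP.
have d0 : 0 < d := gcd_steps_gt0 stp.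
have Srep := apery_rep_spanned j stp Ln; rewrite -/d in Srep.
split=> [[s [t [Ss mt e]]]|le].
- have /dvdnP[q qE] := spanned_dvd Ss; rewrite -/d in qE.
  have {}qE : s = d * q by rewrite mulnC.
  have qj : q %% n = j.
    have /eqP : d * q = d * j %[mod n] by rewrite -xj e -qE addnC modnMDl.
    by rewrite eqn_modMl_coprime // => /eqP->; rewrite modn_small.
  have qdiv := divn_eq q n; rewrite qj in qdiv.
  have [qrep|qrep] : q = apery_rep r d n j \/ apery_rep r d n j + n <= q.
    rewrite /apery_rep; case: ifP => Sj; case: (q %/ n) qdiv => [|[|c]] /= qdiv.
    - by left; lia.
    - by right; lia.
    - by right; lia.
    - by rewrite mul0n add0n in qdiv; rewrite qE qdiv Sj in Ss.
    - by left; lia.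
    - by right; lia.
  + by rewrite /apery -qrep -qE e leq_add2l leq_mul2r mt orbT.
  (* The gap of at least [n > L ^ 2] outweighs the slack between the two linear bounds on the least
     length. *)
  + have lt : d * apery_rep r d n j + n <= s by rewrite qE; nia.
    have up := min_length_upper stp Srep.
    have lo := min_length_lower stp Ss.
    have L0 := steps_to_gt0 stp.
    have mm : min_length r (d * apery_rep r d n j) <= min_length r s by nia.
    rewrite /apery e leq_add ?leq_mul2r ?(leq_trans mm mt) ?orbT //.
    exact: leq_trans (leq_addr _ _) lt.
- have : x == apery r d n j %[mod n] by rewrite modn_apery xj.
  rewrite eqn_mod_dvd // => /dvdnP[c cE].
  exists (d * apery_rep r d n j), (min_length r (d * apery_rep r d n j) + c).
  split => //; first exact: leq_addr.
  by rewrite mulnDl addnA -cE -/(apery r d n j) subnKC.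
Qed.

(** * The genus as a sum over the Apery set *)

Lemma perm_mul_mod n d :
  0 < n -> coprime n d -> perm_eq [seq (d * j) %% n | j <- iota 0 n] (iota 0 n).
Proof.
move=> n0 cnd.
have inj : uniq [seq (d * j) %% n | j <- iota 0 n].
  rewrite map_inj_in_uniq ?iota_uniq // => i j.
  rewrite !mem_iota !add0n /= => iN jN /eqP.
  by rewrite eqn_modMl_coprime // !modn_small // => /eqP.
apply: uniq_perm => //; first exact: iota_uniq.
apply: (uniq_min_size inj _ _).2; last by rewrite size_map.
by move=> x /mapP[j _ ->]; rewrite mem_iota add0n ltn_pmod.
Qed.

(** Sum the divisions with remainder of [d * j] by [n]: the remainders permute [0, ..., n - 1], so
    their total is known. *)
Lemma sum_floor_mul n d : 0 < n -> 0 < d -> coprime n d ->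
  2 * (\sum_(0 <= j < n) (d * j) %/ n) = (d - 1) * (n - 1).
Proof.
move=> n0 d0 cnd.
have tri : 2 * \sum_(0 <= j < n) j = n * (n - 1).
  elim: (n) => [|m IH]; first by rewrite big_nil.
  by rewrite big_nat_recr //= mulnDr IH; case: m {IH} => //= m; rewrite !subn1 /=; ring.
have resid : \sum_(0 <= j < n) (d * j) %% n = \sum_(0 <= j < n) j.
  rewrite /index_iota subn0 -(big_map (fun j => (d * j) %% n) xpredT id).
  exact: perm_big (perm_mul_mod n0 cnd).
have : \sum_(0 <= j < n) d * j =
    (\sum_(0 <= j < n) (d * j) %/ n) * n + \sum_(0 <= j < n) (d * j) %% n.
  by rewrite big_distrl -big_split /=; apply: eq_bigr => j _; apply: divn_eq.
rewrite resid -big_distrr /=; nia.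
Qed.

(** In each class modulo [n] the gaps are the numbers below the Apery element, which the quotient by
    [n] counts. *)
Lemma genus_apery r L n (d := \big[gcdn/0]_(x <- r) x) :
  steps_to r L -> L ^ 2 < n -> coprime n d ->
  genus (shifted_monoid r n) = \sum_(0 <= j < n) apery r d n j %/ n.
Proof.
move=> stp Ln cnd; have n0 : 0 < n by lia.
pose gaps := [seq (d * j) %% n + q * n |
  j <- iota 0 n, q <- iota 0 (apery r d n j %/ n)].
have gapsP x j : x = d * j %[mod n] ->
    (x < apery r d n j) = (x %/ n < apery r d n j %/ n).
  move=> xj; rewrite {1}(divn_eq x n) {1}(divn_eq (apery r d n j) n).
  rewrite modn_apery xj; have := ltn_pmod (d * j) n0; nia.
have class x : exists2 j, j < n & x = d * j %[mod n].
  have : x %% n \in [seq (d * j) %% n | j <- iota 0 n].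
    by rewrite (perm_mem (perm_mul_mod n0 cnd)) mem_iota add0n ltn_pmod.
  by case/mapP => j; rewrite mem_iota add0n => jn ->; exists j.
have gapsE : (~` shifted_monoid r n = [set` gaps])%classic.
  apply/seteqP; split => x /=.
  - have [j jn xj] := class x.
    rewrite (shifted_monoid_apery stp Ln cnd jn xj) => /negP.
    rewrite -ltnNge gapsP // => lt.
    apply/allpairsPdep; exists j, (x %/ n).
    by rewrite !mem_iota !add0n; split=> //; rewrite -xj addnC -divn_eq.
  - move=> /allpairsPdep[j [q]]; rewrite !mem_iota !add0n => -[jn qn xE].
    have xj : x = d * j %[mod n] by rewrite xE addnC modnMDl modn_mod.
    rewrite (shifted_monoid_apery stp Ln cnd jn xj) => /negP; apply; apply/negP.
    rewrite -ltnNge gapsP // xE addnC divnMDl // divn_small ?ltn_pmod //.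
    by rewrite addn0.
have ug : uniq gaps.
  apply: allpairs_uniq_dep => [|j _|]; rewrite ?iota_uniq //.
  move=> [i p] [j q] /allpairsPdep[i' [p' [ii _ /(congr1 tag) /= ei]]].
  move=> /allpairsPdep[j' [q' [jj _ /(congr1 tag) /= ej]]] /= e.
  rewrite -ei mem_iota add0n /= in ii; rewrite -ej mem_iota add0n /= in jj.
  have ij : i = j.
    have /eqP : d * i = d * j %[mod n].
      by have := congr1 (modn^~ n) e; rewrite /= !(addnC (_ %% n)) !modnMDl !modn_mod.
    by rewrite eqn_modMl_coprime // !modn_small // => /eqP.
  rewrite ij in e *; move/eqP: e; rewrite eqn_add2l eqn_pmul2r //.
  by move=> /eqP->.
(* Exhibiting the complement as a finite set keeps [fset_set] away from its default value. *)
have gapsF : ([set` gaps] = [set` [fset x in gaps]%fset])%classic.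
  by apply/seteqP; split => x /=; rewrite !inE.
rewrite /genus gapsE gapsF set_fsetK card_fseq undup_id // size_allpairs_dep.
rewrite sumnE big_map /index_iota subn0.
by apply: eq_bigr => j _; rewrite size_iota.
Qed.

(** When [d * j] is not spanned, the representative [j + n] adds [d * n] to the Apery element, hence
    [d] to the floor. *)
Lemma apery_floor r d n j : 0 < n ->
  apery r d n j %/ n = min_length r (d * apery_rep r d n j)
    + (d * j) %/ n + d * ~~ spanned r (d * j).
Proof.
move=> n0; rewrite /apery (addnC (d * _)) divnMDl // /apery_rep.
case: ifP => _ /=; first by rewrite muln0 addn0.
by rewrite mulnDr (addnC (d * j)) divnMDl // muln1 -addnA (addnC d).
Qed.

Lemma apery_rep_large r L n j (d := \big[gcdn/0]_(x <- r) x) :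
  steps_to r L -> L ^ 2 <= j -> apery_rep r d n j = j.
Proof. by move=> stp jL; rewrite /apery_rep (spanned_large stp jL). Qed.

(** From [K] on every [d * j] is spanned, so the corrections live on [j < K]. Doubling clears the
    denominator of the floor sum. *)
Lemma double_genus r L n (d := \big[gcdn/0]_(x <- r) x) (K := (L ^ 2).+1) :
  steps_to r L -> K <= n -> coprime n d ->
  2 * genus (shifted_monoid r n) = (d - 1) * (n - 1)
    + 2 * (\sum_(0 <= j < K) min_length r (d * apery_rep r d n j)
           + \sum_(K <= j < n) min_length r (d * j)
           + \sum_(0 <= j < K) d * ~~ spanned r (d * j)).
Proof.
move=> stp Kn cnd; have n0 : 0 < n by exact: leq_trans Kn.
have d0 : 0 < d := gcd_steps_gt0 stp.
rewrite (genus_apery stp) // (eq_bigr _ (fun j _ => apery_floor r d j n0)).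
rewrite !big_split /= !mulnDr sum_floor_mul //.
rewrite (@big_cat_nat _ _ _ K 0 n) //= (@big_cat_nat _ _ _ K 0 n _ (fun j => d * _)) //=.
rewrite (eq_big_nat _ _ (F2 := fun j => min_length r (d * j)) (m := K)); last first.
  by move=> j /andP[Kj _]; rewrite (apery_rep_large _ stp) // ltnW.
have -> : \sum_(K <= j < n) d * ~~ spanned r (d * j) = 0.
  rewrite big_nat big1 // => j /andP[Kj _].
  by rewrite (spanned_large stp) ?muln0 // ltnW.
ring.
Qed.

(** * The second difference of the genus *)

(** In [double_genus], the linear term and the head sum [E] have zero second difference with step
    [L]; the tail sum [A] supplies [d * L]. *)
Lemma genus_second_difference r L n (d := \big[gcdn/0]_(x <- r) x) :
  steps_to r L -> L ^ 2 < n -> coprime n d ->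
  genus (shifted_monoid r (n + 2 * L)) + genus (shifted_monoid r n) =
  2 * genus (shifted_monoid r (n + L)) + d * L.
Proof.
move=> stp Ln cnd; have L0 := steps_to_gt0 stp.
have d0 : 0 < d := gcd_steps_gt0 stp.
have step j : L ^ 2 <= j -> min_length r (d * (j + L)) = min_length r (d * j) + d.
  move=> jL; rewrite mulnDr (min_length_add_mul _ stp) ?(spanned_large stp) //.
  by nia.
pose K := (L ^ 2).+1.
pose E m := \sum_(0 <= j < K) min_length r (d * apery_rep r d m j).
pose A m := \sum_(K <= j < m) min_length r (d * j).
(* Only the indices with [d * j] not spanned depend on [m]; each gains [d] when [m] grows by [L]. *)
have ED : exists e, forall m, L ^ 2 < m -> E (m + L) = E m + e.
  exists (\sum_(0 <= j < K) d * ~~ spanned r (d * j)) => m mL.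
  rewrite -big_split /=; apply: eq_bigr => j _.
  rewrite /apery_rep; case: ifP => _ /=; first by rewrite muln0 addn0.
  by rewrite addnA step ?muln1 //; lia.
have [e Ee] := ED.
have A1 : A (n + L) = A n + \sum_(n <= j < n + L) min_length r (d * j).
  by rewrite /A -big_cat_nat //=; lia.
(* The second window of [L] terms is the first one shifted by [L], so each term gains [d]. *)
have A2 : A (n + L + L) =
    A (n + L) + \sum_(n <= j < n + L) min_length r (d * j) + d * L.
  rewrite /A (@big_cat_nat _ _ _ (n + L) K (n + L + L)) /=; try lia.
  rewrite -[RHS]addnA; congr (_ + _).
  rewrite big_addn addnK (eq_big_nat _ _ (F2 := fun j => min_length r (d * j) + d)).
    by rewrite big_split /= sum_nat_const_nat addKn mulnC.
  by move=> j /andP[nj _]; apply: step; lia.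
have n1 : L ^ 2 < n + L by lia.
have n2 : L ^ 2 < n + 2 * L by lia.
have cn1 : coprime (n + L) d by rewrite (coprime_add_steps _ stp).
have cn2 : coprime (n + 2 * L) d.
  by rewrite mul2n -addnn addnA !(coprime_add_steps _ stp).
have := double_genus stp Ln cnd.
have := double_genus stp n1 cn1.
have := double_genus stp n2 cn2.
rewrite -/d -/K -/(E n) -/(E (n + L)) -/(E (n + 2 * L)).
rewrite -/(A n) -/(A (n + L)) -/(A (n + 2 * L)).
have -> : n + 2 * L = n + L + L by lia.
rewrite A2 A1 !Ee //.
move: (E n) (A n) (\sum_(n <= j < n + L) _) (\sum_(0 <= j < K) _) => En An Sn W.
move: (genus _) (genus _) (genus _) => g0 g1 g2 h2 h1 h0.
have nn : n - 1 + 2 * L = n + L + L - 1 by lia.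
have nn1 : n - 1 + L = n + L - 1 by lia.
rewrite -nn in h2; rewrite -nn1 in h1; nia.
Qed.

(** * From constant second differences to quasiquadratic functions *)

Import GRing.Theory Num.Theory.
Local Open Scope ring_scope.

(** With step [L], the square has second difference [2 * L ^ 2]; subtracting [a2] times it cancels
    [c] and leaves an arithmetic progression. *)
Lemma quadratic_of_second_difference (F : numFieldType) (f : nat -> F)
    (m L : nat) (c : F) :
  (0 < L)%N ->
  (forall q, f (m + q * L + 2 * L)%N + f (m + q * L)%N
             = 2 * f (m + q * L + L)%N + c) ->
  let a2 := c / (2 * L%:R ^+ 2) in
  let h n := f n - a2 * n%:R ^+ 2 in
  forall q, h (m + q * L)%N = h m + q%:R * (h (m + L)%N - h m).
Proof.
move=> L0 H a2 h.
have Ln : L%:R != 0 :> F by rewrite pnatr_eq0 -lt0n.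
have c2 : c = a2 * (2 * L%:R ^+ 2).
  by rewrite /a2 divfK // mulf_neq0 ?expf_neq0 // pnatr_eq0.
have hH q : h (m + q * L + 2 * L)%N = 2 * h (m + q * L + L)%N - h (m + q * L)%N.
  have /(canRL (addrK _)) fE := H q.
  rewrite /h fE {1}c2 !natrD !natrM; ring.
(* The recurrence has order two, so the induction carries two consecutive values. *)
suff HH q : h (m + q * L)%N = h m + q%:R * (h (m + L)%N - h m) /\
  h (m + q.+1 * L)%N = h m + q.+1%:R * (h (m + L)%N - h m) by move=> q; case: (HH q).
elim: q => [|q [IH1 IH2]].
  by rewrite mul0n addn0 mul0r addr0 mul1n mul1r addrC subrK.
split=> //.
have -> : (m + q.+2 * L = m + q * L + 2 * L)%N by lia.
rewrite hH IH1 (_ : m + q * L + L = m + q.+1 * L)%N; last by lia.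
rewrite IH2 -!natr1; ring.
Qed.

Lemma quasiquadratic_of_second_difference (F : numFieldType) (f : nat -> F)
    (P : nat -> bool) (N L : nat) (c : F) :
  (0 < L)%N -> (forall n, P (n + L)%N = P n) ->
  (forall n, (N < n)%N -> P n ->
     f (n + 2 * L)%N + f n = 2 * f (n + L)%N + c) ->
  exists a0 a1 : int -> F,
    [/\ period_dividing a0 L, period_dividing a1 L &
        forall n, (N < n)%N -> P n ->
          f n = c / (2 * L%:R ^+ 2) * n%:R ^+ 2 + a1 n%:Z * n%:R + a0 n%:Z].
Proof.
move=> L0 PL H.
have Ln : L%:R != 0 :> F by rewrite pnatr_eq0 -lt0n.
pose a2 : F := c / (2 * L%:R ^+ 2).
pose h n := f n - a2 * n%:R ^+ 2.
(* The least integer above [N] congruent to [x] modulo [L]. Slope and intercept are read off there,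
   which makes them periodic. *)
pose rep (x : int) : nat := (N.+1 + `|((x - N.+1%:Z) %% L%:Z)%Z|)%N.
have repL x : rep (x + L%:Z) = rep x by rewrite /rep addrAC modzDr.
pose a1 x := (h (rep x + L)%N - h (rep x)) / L%:R.
pose a0 x := h (rep x) - a1 x * (rep x)%:R.
have a1L x : a1 (x + L%:Z) = a1 x by rewrite /a1 repL.
exists a0, a1; split.
- by exists L; split=> // x; rewrite /a0 a1L repL.
- by exists L; split.
- move=> n Nn Pn.
  have [q nE] : exists q, n = (rep n%:Z + q * L)%N.
    exists ((n - N.+1) %/ L)%N.
    rewrite /rep subzn // modz_nat absz_nat -addnA [((n - N.+1) %% L + _)%N]addnC.
    by rewrite -divn_eq subnKC.
  set m := rep n%:Z in nE *.
  have PqL p : P (m + p * L)%N = P m.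
    by elim: p => [|p IH]; rewrite ?addn0 // mulSnr addnA PL.
  have := @quadratic_of_second_difference F f m L c L0 _ q.
  rewrite -/a2 -/(h _) -nE => E.
  have {}E : h n = h m + q%:R * (a1 n%:Z * L%:R).
    rewrite /a1 divfK //; apply: E => p; apply: H; last by rewrite PqL -(PqL q) -nE.
    by rewrite /m /rep; lia.
  rewrite -/a2 /a0 -/m addrAC.
  have -> : f n = a2 * n%:R ^+ 2 + h n by rewrite /h addrC subrK.
  rewrite E -addrA; congr (_ + _).
  rewrite [X in _ = _ + _ * X](_ : _ = m%:R + q%:R * L%:R); last first.
    by rewrite -natrM -natrD -nE.
  ring.
Qed.

Theorem corollary4p2 (R : realType) (k : nat) (r : k.-tuple nat)
    (hk : (1 <= k)%N) (hr : path ltn 0%N r) :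
  let rk := last 0%N r in
  let d := (\big[gcdn/0]_(x <- r) x)%N in
  exists a0 a1 a2 : int -> R,
    [/\ period_dividing a0 rk,
        period_dividing a1 rk,
        period_dividing a2 rk,
        exists x : int, coprimez x d%:Z /\ a2 x != 0 &
        forall n : nat, (rk ^ 2 < n)%N -> coprime n d ->
          (genus (shifted_monoid r n))%:R =
            a2 n%:Z * n%:R ^+ 2 + a1 n%:Z * n%:R + a0 n%:Z].
Proof.
move=> rk d.
have stp : steps_to r rk.
  split.
    rewrite /rk; case: (tval r) (size_tuple r) hk => [<- //|x s _ _].
    exact: mem_last.
  move=> x xr; rewrite (allP (order_path_min ltn_trans hr) _ xr) /=.
  rewrite /rk; case/splitPr: xr hr => p q; rewrite cat_path last_cat /= => /and3P[_ _].
  move=> /(order_path_min ltn_trans)/allP xq.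
  have := mem_last x q; rewrite in_cons => /predU1P[->//|/xq].
  exact: ltnW.
have L0 := steps_to_gt0 stp.
have d0 : (0 < d)%N := gcd_steps_gt0 stp.
have [|a0 [a1 [p0 p1 H]]] := @quasiquadratic_of_second_difference R
  (fun n => (genus (shifted_monoid r n))%:R) (fun n => coprime n d) (rk ^ 2) rk
  (d * rk)%:R L0 (fun n => coprime_add_steps n stp).
  move=> n Ln cnd; rewrite -natrM -!natrD.
  by rewrite (genus_second_difference stp Ln cnd).
(* The leading coefficient is the constant [d / (2 * rk)], so period 1 serves, and the integer 1
   witnesses that it is nonzero at a point coprime to [d]. *)
exists a0, a1, (fun=> (d * rk)%:R / (2 * rk%:R ^+ 2)); split => //.
- by exists 1%N.
- exists 1; split; first by rewrite /coprimez gcd1z.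
  by rewrite mulf_neq0 ?invr_eq0 ?mulf_neq0 ?expf_neq0 ?pnatr_eq0 // -lt0n ?muln_gt0 ?d0.
Qed.
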